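(* Over $\mathfrak{S}_n$, the following quadruples of statistics all have the same joint distribution: (1) $(\mathsf{inv},\mathsf{rmin},\mathsf{lmin},\mathsf{lmax})$; (2) $(\mathsf{sor},\mathsf{cyc},\mathsf{lmic}_1,\mathsf{lmax})$; (3) $(\mathsf{inv},\mathsf{lmax},\mathsf{lmin},\mathsf{rmin})$; (4) $(\mathsf{inv},\mathsf{rmin},\mathsf{rmax},\mathsf{lmax})$; (5) $(\mathsf{inv},\mathsf{lmax},\mathsf{rmax},\mathsf{rmin})$; (6) $(\binom n2-\mathsf{inv},\mathsf{lmin},\mathsf{rmin},\mathsf{rmax})$; (7) $(\binom n2-\mathsf{inv},\mathsf{rmax},\mathsf{lmax},\mathsf{lmin})$; (8) $(\binom n2-\mathsf{inv},\mathsf{rmax},\mathsf{rmin},\mathsf{lmin})$; (9) $(\binom n2-\mathsf{inv},\mathsf{lmin},\mathsf{lmax},\mathsf{rmax})$; (10) $(\mathsf{sor},\mathsf{lmax},\mathsf{lmic}_1,\mathsf{cyc})$. Moreover, the following partial quadruples (a dash means the entry is omitted) have the same joint distribution as the entries in the same positions of quadruple (1): (11) $(\binom n2-\mathsf{sor},\mathsf{lmic}_1,\mathsf{cyc},-)$; (12) $(\binom n2-\mathsf{sor},-,\mathsf{lmax},\mathsf{lmic}_1)$; (13) $(\binom n2-\mathsf{sor},-,\mathsf{cyc},\mathsf{lmic}_1)$; (14) $(\binom n2-\mathsf{sor},\mathsf{lmic}_1,\mathsf{lmax},-)$; (15) $(-,\mathsf{cyc},-,\mathsf{rmin})$; (16)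 $(-,\mathsf{rmin},-,\mathsf{cyc})$; (17) $(\mathsf{maj},\mathsf{rmin},\mathsf{rmax},-)$; (18) $(\mathsf{imaj},\mathsf{lmax},\mathsf{rmax},-)$; (19) $(\mathsf{rmaj},\mathsf{lmax},\mathsf{lmin},-)$; (20) $(\mathsf{chg},\mathsf{rmin},\mathsf{lmin},-)$; (21) $(\mathsf{cochg},\mathsf{lmin},\mathsf{rmin},-)$. Consequently, for each (partial) quadruple $(s_1,s_2,s_3,\cdot)$ above whose first three entries are all present, $$\sum_{\sigma\in\mathfrak{S}_n}q^{s_1(\sigma)}x^{s_2(\sigma)}y^{s_3(\sigma)}=xy\prod_{r=2}^{n}\bigl(x+[r]_q+yq^{r-1}-1-q^{r-1}\bigr),$$ where $[r]_q=1+q+\dots+q^{r-1}$.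
   Context: $\mathfrak{S}_n$ is the symmetric group on $[n]$, permutations in one-line notation $\sigma=\sigma_1\cdots\sigma_n$, products composed right to left. $\mathsf{inv}(\sigma)=\#\{(i,j):i<j,\ \sigma_i>\sigma_j\}$. $\mathsf{rmin},\mathsf{rmax},\mathsf{lmin},\mathsf{lmax}$ are the numbers of right-to-left minima, right-to-left maxima, left-to-right minima, left-to-right maxima of $\sigma$ (e.g. $\mathsf{rmin}(\sigma)=\#\{i:\sigma_i<\sigma_j\ \forall j>i\}$, $\mathsf{lmax}(\sigma)=\#\{i:\sigma_i>\sigma_j\ \forall j<i\}$). $\mathsf{cyc}(\sigma)$ is the number of cycles of $\sigma$. Sorting index: write $\sigma=(i_1\,j_1)\cdots(i_k\,j_k)$ uniquely with $j_1<\dots<j_k$, $i_r<j_r$; $\mathsf{sor}(\sigma)=\sum_r(j_r-i_r)$. $B$-code: $B(\sigma)=(b_1,\dots,b_n)$, $b_i=\sigma^{-k_i}(i)$ with $k_i\ge1$ smallest such that $\sigma^{-k_i}(i)\le i$; $\mathsf{lmic}_1(\sigma)=\#\{i:b_i=1\}$. Reverse $\sigma^r=\sigma_n\cdots\sigma_1$, complement $\sigma^c=(n+1-\sigma_1)\cdots(n+1-\sigma_n)$, $\sigma^{rc}=(\sigma^c)^r$. $\mathsf{Des}(\sigma)=\{i\in[n-1]:\sigma_i>\sigma_{i+1}\}$; $\mathsf{maj}(\sigma)=\sum_{i\in\mathsf{Des}(\sigma)}i$; $\mathsf{imaj}(\sigma)=\mathsf{maj}(\sigma^{-1})$; $\mathsf{rmaj}(\sigma)=\mathsf{maj}(\sigma^{rc})$;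 $\mathsf{chg}(\sigma)=\sum_{i\in\mathsf{Des}(\sigma^{-1})}(n-i)$; $\mathsf{cochg}(\sigma)=\sum_{i\in[n-1]\setminus\mathsf{Des}(\sigma^{-1})}(n-i)$. *)

(* Defs.v *)
From HB Require Import structures.
From mathcomp Require Import all_boot all_order all_fingroup all_algebra.
Set Implicit Arguments.
Unset Strict Implicit.
Unset Printing Implicit Defensive.
Import GRing.Theory.

(* Permutations of [n] are elements of 'S_n = {perm 'I_n}, so positions and
   values are shifted down by one: i : 'I_n stands for i.+1 in [n]. MathComp
   composes permutations left to right: (s * t) i = t (s i). *)

Section Statistics.
Variable n : nat.
Implicit Types (s : 'S_n) (w : seq ('I_n * 'I_n)).

Definition ninv s : nat :=
  #|[set p : 'I_n * 'I_n | (p.1 < p.2) && (s p.2 < s p.1)]|.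

Definition rmin s : nat :=
  #|[set i : 'I_n | [forall j : 'I_n, (i < j) ==> (s i < s j)]]|.
Definition rmax s : nat :=
  #|[set i : 'I_n | [forall j : 'I_n, (i < j) ==> (s j < s i)]]|.
Definition lmin s : nat :=
  #|[set i : 'I_n | [forall j : 'I_n, (j < i) ==> (s i < s j)]]|.
Definition lmax s : nat :=
  #|[set i : 'I_n | [forall j : 'I_n, (j < i) ==> (s j < s i)]]|.

(* Fixed points count as cycles. *)
Definition cyc s : nat := #|porbits s|.

(* w = [:: (i_1, j_1); ...; (i_k, j_k)] is the factorisation
   s = (i_1 j_1) ... (i_k j_k), i_r < j_r, j_1 < ... < j_k, where the product
   is composed right to left; hence the rev. *)
Definition sort_fact s w : bool :=
  [&& all (fun t : 'I_n * 'I_n => t.1 < t.2) w,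
      sorted ltn [seq val t.2 | t <- w]
    & s == (\prod_(t <- rev w) tperm t.1 t.2)%g].

Lemma sort_fact_rcons s w (i j : 'I_n) :
  sort_fact s (rcons w (i, j)) =
  [&& i < j, all (fun t : 'I_n * 'I_n => t.2 < j) w & sort_fact (tperm i j * s)%g w].
Proof.
rewrite /sort_fact all_rcons /= map_rcons rev_rcons big_cons /=.
have -> : (s == tperm i j * \prod_(t <- rev w) tperm t.1 t.2)%g =
    (tperm i j * s == \prod_(t <- rev w) tperm t.1 t.2)%g.
  by rewrite -(inj_eq (mulgI (tperm i j)) s) mulgA tperm2 mul1g.
have -> : sorted ltn (rcons [seq val t.2 | t <- w] j) =
    all (fun t : 'I_n * 'I_n => t.2 < j) w && sorted ltn [seq val t.2 | t <- w].
  rewrite -[rcons _ _]revK rev_sorted rev_rcons /=.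
  rewrite path_sortedE; last by move=> a b c ba ac; apply: ltn_trans ac ba.
  by rewrite all_rev all_map -rev_sorted revK.
by case: (i < j); rewrite ?andbF //=; case: (all (fun t : 'I_n * 'I_n => t.2 < j) w);
  rewrite ?andbF.
Qed.

Lemma sort_fact_fix s w (m : nat) (i : 'I_n) :
  sort_fact s w -> all (fun t : 'I_n * 'I_n => t.2 < m) w -> m <= i -> s i = i.
Proof.
case/and3P=> lt_w _ /eqP->.
elim/last_ind: w lt_w => [|w t IHw]; first by rewrite big_nil perm1.
rewrite !all_rcons rev_rcons big_cons permM => /andP[lt_t lt_w] /andP[tm wm] mi.
rewrite tpermD ?IHw //; rewrite -val_eqE neq_ltn.
  by rewrite (ltn_trans lt_t (leq_trans tm mi)).
by rewrite (leq_trans tm mi).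
Qed.

Lemma sort_fact_ex s : exists w, sort_fact s w.
Proof.
suff ex_m m s' : m <= n -> (forall i : 'I_n, m <= i -> s' i = i) ->
    exists2 w, sort_fact s' w & all (fun t : 'I_n * 'I_n => t.2 < m) w.
  have [i|w sw _] := ex_m n s (leqnn n); last by exists w.
  by rewrite leqNgt ltn_ord.
elim: m s' => {s} [|m IHm] s le_mn fix_s.
  exists [::] => //; rewrite /sort_fact /= big_nil; apply/eqP/permP=> i.
  by rewrite perm1 fix_s.
pose j := Ordinal le_mn; pose i := (s^-1)%g j.
have si : s i = j by rewrite permKV.
have le_ij : i <= j.
  by rewrite leqNgt; apply/negP=> lt_ji; move: (lt_ji); rewrite -(fix_s i) // si ltnn.
case: (eqVneq i j) => [eq_ij | ne_ij].
  have [||w sw wm] := IHm s; first exact: ltnW.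
    move=> k; rewrite leq_eqVlt => /predU1P[mk|]; last exact: fix_s.
    have -> : k = j by apply: val_inj.
    by rewrite -{1}eq_ij.
  by exists w => //; apply: sub_all wm => t /ltnW.
have lt_ij : i < j by rewrite ltn_neqAle le_ij andbT.
have [||w sw wm] := IHm (tperm i j * s)%g; first exact: ltnW.
  move=> k; rewrite permM leq_eqVlt => /predU1P[mk|lt_mk].
    have -> : k = j by apply: val_inj.
    by rewrite tpermR.
  rewrite tpermD ?fix_s //; rewrite -val_eqE neq_ltn; last by rewrite lt_mk.
  by rewrite (ltn_trans lt_ij lt_mk).
exists (rcons w (i, j)); first by rewrite sort_fact_rcons lt_ij sw wm.
by rewrite all_rcons /= ltnSn; apply: sub_all wm => t /ltnW.
Qed.

Lemma sort_fact_uniq s w1 w2 : sort_fact s w1 -> sort_fact s w2 -> w1 = w2.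
Proof.
have last_moved s' w (i j : 'I_n) : sort_fact s' (rcons w (i, j)) ->
    [/\ i < j, s' i = j & forall k : 'I_n, j < k -> s' k = k].
  move=> sw; move: (sw); rewrite sort_fact_rcons => /and3P[lt_ij wj sw'].
  split=> //.
    by rewrite -(sort_fact_fix sw' wj (leqnn j)) permM tpermR.
  move=> k; apply: sort_fact_fix sw _; rewrite all_rcons /= ltnSn.
  by apply: sub_all wj => t /ltnW.
have not1 w i j : ~ sort_fact 1%g (rcons w (i, j)).
  by case/last_moved; rewrite perm1 => lt_ij eq_ij; move: lt_ij; rewrite eq_ij ltnn.
have nilE s' : sort_fact s' [::] -> s' = 1%g.
  by rewrite /sort_fact /= big_nil => /eqP.
elim/last_ind: w1 s w2 => [|w1 [i1 j1] IHw] s w2; case/lastP: w2 => [|w2 [i2 j2]] //.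
- by move/nilE-> => /not1.
- by move=> h /nilE s1; move: h; rewrite s1 => /not1.
move=> sw1 sw2; have [lt1 e1 f1] := last_moved _ _ _ _ sw1.
have [lt2 e2 f2] := last_moved _ _ _ _ sw2.
have ej : j1 = j2.
  apply: val_inj; case: (ltngtP (val j1) (val j2)) => // lt_j.
    have := f1 _ lt_j; rewrite -{2}e2 => /perm_inj eq_ij.
    by move: lt2; rewrite -eq_ij ltnn.
  have := f2 _ lt_j; rewrite -{2}e1 => /perm_inj eq_ij.
  by move: lt1; rewrite -eq_ij ltnn.
have ei : i1 = i2 by apply: (@perm_inj _ s); rewrite e1 e2.
move: sw1 sw2; rewrite !sort_fact_rcons -ej -ei => /and3P[_ _ h1] /and3P[_ _ h2].
by rewrite (IHw _ _ h1 h2).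
Qed.

Definition sor s : nat :=
  \sum_(t <- xchoose (sort_fact_ex s)) (t.2 - t.1).

Lemma Bcode_ex s (i : 'I_n) : exists k : nat, (0 < k) && ((s ^- k)%g i <= i).
Proof. by exists #[s]%g; rewrite order_gt0 expg_order invg1 perm1 leqnn. Qed.

Definition Bcode s (i : 'I_n) : 'I_n := (s ^- ex_minn (Bcode_ex s i))%g i.

(* The value 1 of [n] is encoded as 0. *)
Definition lmic1 s : nat := #|[set i : 'I_n | Bcode s i == 0 :> nat]|.

Definition revp s : 'S_n := (perm (@rev_ord_inj n) * s)%g.
Definition compl s : 'S_n := (s * perm (@rev_ord_inj n))%g.

(* The descent at position i.+1 of [n - 1] is encoded as i. *)
Definition Des s : {set 'I_n} :=
  [set i : 'I_n | [exists j : 'I_n, (j == i.+1 :> nat) && (s j < s i)]].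

Definition maj s : nat := \sum_(i in Des s) i.+1.
Definition imaj s : nat := maj s^-1%g.
Definition rmaj s : nat := maj (revp (compl s)).
Definition chg s : nat := \sum_(i in Des s^-1%g) (n - i.+1).
Definition cochg s : nat :=
  \sum_(i : 'I_n | (i.+1 < n) && (i \notin Des s^-1%g)) (n - i.+1).

(* The next two lemmas show that these truncated subtractions are exact. *)
Definition coinv s : nat := 'C(n, 2) - ninv s.
Definition cosor s : nat := 'C(n, 2) - sor s.

Lemma ninv_le s : ninv s <= 'C(n, 2).
Proof.
rewrite -bin2_sum big_mkord.
have -> : \sum_(j < n) j = #|[set p : 'I_n * 'I_n | p.1 < p.2]|.
  rewrite -sum1dep_card -(pair_big_dep xpredT (fun i j : 'I_n => i < j) (fun _ _ => 1)) /=.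
  rewrite (exchange_big_dep xpredT) //=; apply: eq_bigr => j _.
  rewrite sum1_card -[LHS]card_ord.
  have lt_in (i : 'I_j) : i < n by apply: ltn_trans (ltn_ord j).
  have inj_f : injective (fun i : 'I_j => Ordinal (lt_in i)).
    by move=> i k /(congr1 val) /= /val_inj.
  rewrite -(card_codom inj_f); apply: eq_card => i; rewrite [RHS]unfold_in.
  apply/codomP/idP => [[k ->] /=|lt_ij]; first exact: ltn_ord.
  by exists (Ordinal lt_ij); apply: val_inj.
by apply: subset_leq_card; apply/subsetP=> p; rewrite !inE => /andP[].
Qed.

Lemma sor_le s : sor s <= 'C(n, 2).
Proof.
rewrite /sor; case/and3P: (xchooseP (sort_fact_ex s)).
move: (xchoose _) => w _ srt _.
apply: (@leq_trans (\sum_(t <- w) t.2)).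
  by apply: leq_sum => t _; apply: leq_subr.
rewrite -bin2_sum -(big_map (fun t : 'I_n * 'I_n => t.2) xpredT (fun j : 'I_n => val j)).
rewrite big_mkord (big_uniq _) /=; last first.
  by rewrite -(map_inj_uniq val_inj) -map_comp; apply: (sorted_uniq ltn_trans ltnn).
by rewrite [leqLHS]big_mkcond; apply: leq_sum => j _; case: ifP.
Qed.

Definition equidistributed (T : eqType) (f g : 'S_n -> T) : Prop :=
  forall v : T, #|[set s | f s == v]| = #|[set s | g s == v]|.

Local Open Scope ring_scope.

Definition qint (R : comNzRingType) (q : R) (r : nat) : R :=
  \sum_(i < r) q ^+ i.

(* Identity of polynomials in q, x, y, stated as an identity under every
   evaluation of q, x, y in a commutative ring. *)
Definition gf_identity (s1 s2 s3 : 'S_n -> nat) : Prop :=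
  forall (R : comNzRingType) (q x y : R),
    \sum_(s : 'S_n) q ^+ s1 s * x ^+ s2 s * y ^+ s3 s =
    x * y * \prod_(2 <= r < n.+1)
      (x + qint q r + y * q ^+ (r - 1) - 1 - q ^+ (r - 1)).

End Statistics.

(* Main.v *)
Require Import Defs.
From mathcomp Require Import all_boot all_order all_fingroup all_algebra.
From mathcomp Require Import zify ring.
Set Implicit Arguments.
Unset Strict Implicit.
Unset Printing Implicit Defensive.
Import GRing.Theory.

(* A permutation of [n + 1] arises from a permutation s of [n] and a position i
   in two ways: by inserting the value n + 1 at position i, or by multiplying s
   by the transposition (i, n + 1). The first way changes inv, rmin and lmin
   exactly as the second changes sor, cyc and lmic1: inv and sor grow by
   n + 1 - i, rmin and cyc by [i = n + 1], lmin and lmic1 by [i = 1]. In both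
   cases the new set of left-to-right maxima positions consists of i and of the
   old positions smaller than i. Iterating gives a bijection that proves (2), and
   the same recursion gives the product formula.

   Foata's second fundamental transformation sends maj to inv, and it preserves
   the right-to-left minima and maxima because its step at a letter x keeps the
   relative order of the letters at most x and of the letters above x. This
   gives (17). The other statements follow through inversion, reversal and
   complementation. *)

Lemma card_set_sum (T : finType) (P : pred T) : #|[set x | P x]| = \sum_x P x.
Proof. by rewrite -sum1dep_card big_mkcond; apply: eq_bigr => x _; case: (P x). Qed.

Lemma sum_ord_geq (n m : nat) : \sum_(j < n) (m <= j) = n - m.
Proof.
elim: n => [|n IHn]; first by rewrite big_ord0.
by rewrite big_ord_recr /= IHn; case: (leqP m n) => /=; lia.
Qed.

Lemma ltn_lift n (i : 'I_n.+1) (a b : 'I_n) : (lift i a < lift i b) = (a < b).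
Proof. by rewrite /= !ltnNge leq_bump2. Qed.

Lemma forall_ord_lift n (i : 'I_n.+1) (P : pred 'I_n.+1) :
  [forall j, P j] = P i && [forall j : 'I_n, P (lift i j)].
Proof.
apply/forallP/andP => [allP | [Pi /forallP allP] j]; first by split=> //; apply/forallP.
by case: (unliftP i j) => [k ->|->].
Qed.

Lemma ltn_ord_max n (i : 'I_n.+1) : (i < @ord_max n) = (i != ord_max).
Proof. by rewrite ltn_neqAle leq_ord andbT. Qed.

Lemma forall_perm (T : finType) (s : {perm T}) (P : pred T) :
  [forall x, P x] = [forall x, P (s x)].
Proof.
apply/forallP/forallP => allP x; first exact: allP.
by rewrite -[x](permKV s).
Qed.

Lemma card_set_perm (T : finType) (s : {perm T}) (P : pred T) :
  #|[set x | P x]| = #|[set x | P (s x)]|.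
Proof. by rewrite !card_set_sum (reindex_inj (@perm_inj _ s)). Qed.

Lemma sum2_perm (T : finType) (s : {perm T}) (F : T -> T -> nat) :
  \sum_x \sum_y F x y = \sum_x \sum_y F (s x) (s y).
Proof.
rewrite (reindex_inj (@perm_inj _ s)); apply: eq_bigr => x _.
exact: (reindex_inj (@perm_inj _ s)).
Qed.

Lemma ninvE n (s : 'S_n) : ninv s = \sum_(i < n) \sum_(j < n) ((i < j) && (s j < s i)).
Proof. by rewrite /ninv card_set_sum pair_big. Qed.

(** * Records *)

Definition ltn_dir (up : bool) : rel nat := fun a b => if up then a < b else b < a.

Lemma ltn_dir_irr up : irreflexive (ltn_dir up).
Proof. by case: up => a; rewrite /ltn_dir ltnn. Qed.

Lemma ltn_dirN up a b : a != b -> ltn_dir (~~ up) a b = ~~ ltn_dir up a b.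
Proof. by rewrite /ltn_dir; case: up => /=; lia. Qed.

Definition ord_end n (up : bool) : 'I_n.+1 := if up then ord_max else ord0.

Lemma ltn_dir_ord_end n up (i : 'I_n.+1) : ltn_dir up i (ord_end n up) = (i != ord_end n up).
Proof. by case: up; rewrite /ltn_dir /ord_end ?ltn_ord_max // lt0n. Qed.

Lemma ord_end_ltn_dir n up (i : 'I_n.+1) : ltn_dir up (ord_end n up) i = false.
Proof. by case: up; rewrite /ltn_dir //= ltnNge leq_ord. Qed.

Lemma ltn_rev_ord n (i j : 'I_n) : (rev_ord i < rev_ord j) = (j < i).
Proof. by have := ltn_ord i; have := ltn_ord j; rewrite /=; lia. Qed.

Lemma ltn_dir_rev_ord n up (i j : 'I_n) :
  ltn_dir up (rev_ord i) (rev_ord j) = ltn_dir (~~ up) i j.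
Proof. by case: up; apply: ltn_rev_ord. Qed.

(* Entries are compared with those on their right if right holds, and on their
   left otherwise; the records are the minima if low holds, and the maxima
   otherwise. *)
Definition records n (right low : bool) (s : 'S_n) : {set 'I_n} :=
  [set i : 'I_n | [forall j : 'I_n, ltn_dir right i j ==> ltn_dir low (s i) (s j)]].

Local Notation lmaxima := (records false false).

Section Symmetries.
Variable n : nat.
Implicit Types (s : 'S_n) (right low : bool).

Lemma recordsE s :
  (rmin s = #|records true true s|) * (rmax s = #|records true false s|) *
  (lmin s = #|records false true s|) * (lmax s = #|records false false s|).
Proof. by []. Qed.

Lemma card_records_inv right low s :
  #|records right low s^-1| = #|records (~~ low) (~~ right) s|.
Proof.
rewrite (card_set_perm s); apply: eq_card => i; rewrite !inE (forall_perm s).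
apply: eq_forallb => j; rewrite !permK.
have [->|ne_ij] := eqVneq i j; first by rewrite !ltn_dir_irr.
have ne_sij : s i != s j :> nat by rewrite (inj_eq val_inj) (inj_eq perm_inj).
by rewrite (ltn_dirN low) // (ltn_dirN right) // implybNN.
Qed.

Lemma revpE s i : revp s i = s (rev_ord i).
Proof. by rewrite /revp permM permE. Qed.

Lemma complE s i : compl s i = rev_ord (s i).
Proof. by rewrite /compl permM permE. Qed.

Lemma revp_inj : injective (@revp n).
Proof. exact: mulgI. Qed.

Lemma compl_inj : injective (@compl n).
Proof. exact: mulIg. Qed.

Lemma card_records_revp right low s :
  #|records right low (revp s)| = #|records (~~ right) low s|.
Proof.
rewrite (card_set_perm (perm rev_ord_inj)); apply: eq_card => i.
rewrite !inE (forall_perm (perm rev_ord_inj)); apply: eq_forallb => j.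
by rewrite !revpE !permE !rev_ordK ltn_dir_rev_ord.
Qed.

Lemma records_compl right low s : records right low (compl s) = records right (~~ low) s.
Proof.
by apply/setP => i; rewrite !inE; apply: eq_forallb => j; rewrite !complE ltn_dir_rev_ord.
Qed.

Lemma record_stats_inv s :
  (rmin s^-1 = lmax s) * (rmax s^-1 = rmax s) * (lmin s^-1 = lmin s) * (lmax s^-1 = rmin s).
Proof. by rewrite !recordsE !card_records_inv. Qed.

Lemma record_stats_revp s :
  (rmin (revp s) = lmin s) * (rmax (revp s) = lmax s) *
  (lmin (revp s) = rmin s) * (lmax (revp s) = rmax s).
Proof. by rewrite !recordsE !card_records_revp. Qed.

Lemma record_stats_compl s :
  (rmin (compl s) = rmax s) * (rmax (compl s) = rmin s) *
  (lmin (compl s) = lmax s) * (lmax (compl s) = lmin s).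
Proof. by rewrite !recordsE !records_compl. Qed.

Lemma cyc_inv s : cyc s^-1 = cyc s.
Proof. by rewrite /cyc porbitsV. Qed.

Lemma ninv_inv s : ninv s^-1 = ninv s.
Proof.
rewrite !ninvE (sum2_perm s) exchange_big; apply: eq_bigr => i _; apply: eq_bigr => j _.
by rewrite !permK andbC.
Qed.

Lemma ninv_compl s : ninv (compl s) = coinv s.
Proof.
suff eq_bin : ninv (compl s) + ninv s = 'C(n, 2) by rewrite /coinv -eq_bin addnK.
rewrite -bin2_sum big_mkord (reindex_inj rev_ord_inj) !ninvE -big_split.
apply: eq_bigr => i _; rewrite -big_split /= -(sum_ord_geq n i.+1); apply: eq_bigr => j _.
case: ltnP => //= lt_ij; rewrite !complE ltn_rev_ord.
have : s i != s j by rewrite (inj_eq perm_inj) -(inj_eq val_inj) ltn_eqF.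
by rewrite -(inj_eq val_inj) /=; lia.
Qed.

Lemma ninv_revp s : ninv (revp s) = coinv s.
Proof.
rewrite -ninv_compl !ninvE (sum2_perm (perm rev_ord_inj)) exchange_big.
apply: eq_bigr => i _; apply: eq_bigr => j _.
by rewrite !revpE !complE !permE !rev_ordK !ltn_rev_ord.
Qed.

Lemma coinv_compl s : coinv (compl s) = ninv s.
Proof. by rewrite {1}/coinv ninv_compl subKn // ninv_le. Qed.

Lemma ninv_revp_compl s : ninv (revp (compl s)) = ninv s.
Proof. by rewrite ninv_revp coinv_compl. Qed.

Lemma sum_Des s (F : 'I_n -> nat) :
  \sum_(i in Des s) F i =
  \sum_(i < n) \sum_(j < n) if (j == i.+1 :> nat) && (s j < s i) then F i else 0.
Proof.
rewrite big_mkcond; apply: eq_bigr => i _; rewrite inE.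
case: existsP => [[j /andP[/eqP def_j lt_sji]]|no_j]; rewrite -big_mkcond; last first.
  by rewrite big1 // => j desc_j; case: no_j; exists j.
rewrite (big_pred1 j) // => k; apply/andP/eqP => [[/eqP def_k _]|->].
  by apply: val_inj; rewrite /= def_k def_j.
by rewrite def_j eqxx.
Qed.

Lemma rmajE s : rmaj s = \sum_(i in Des s) (n - i.+1).
Proof.
rewrite /rmaj /maj !sum_Des (sum2_perm (perm rev_ord_inj)) exchange_big.
apply: eq_bigr => i _; apply: eq_bigr => j _.
rewrite !revpE !complE !permE !rev_ordK ltn_rev_ord /=.
have -> : (n - i.+1 == (n - j.+1).+1) = (j == i.+1 :> nat).
  by have := ltn_ord i; have := ltn_ord j; lia.
by case: eqP => //= def_j; have := ltn_ord j; rewrite def_j; case: ifP => // _; lia.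
Qed.

Lemma chgE s : chg s = rmaj s^-1.
Proof. by rewrite rmajE. Qed.

Lemma revpV s : (revp s)^-1%g = compl s^-1.
Proof.
apply/permP => j; apply: (@perm_inj _ (revp s)).
by rewrite permKV revpE complE rev_ordK permKV.
Qed.

Lemma Des_compl s (i : 'I_n) : (i \in Des (compl s)) = (i.+1 < n) && (i \notin Des s).
Proof.
rewrite !inE; apply/existsP/andP => [[j /andP[/eqP def_j]]|[lt_in /existsPn asc_i]].
  rewrite !complE ltn_rev_ord /= -def_j ltn_ord => lt_sij; split=> //.
  apply/existsPn => k; rewrite negb_and -leqNgt; case: eqP => //= def_k.
  have -> : k = j by apply: val_inj; rewrite /= def_k def_j.
  exact: ltnW.
exists (Ordinal lt_in); have := asc_i (Ordinal lt_in); rewrite eqxx /= -leqNgt.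
rewrite !complE ltn_rev_ord leq_eqVlt => /orP[|//].
by rewrite (inj_eq val_inj) (inj_eq perm_inj) -(inj_eq val_inj) /= ltn_eqF.
Qed.

Lemma cochgE s : cochg s = chg (revp s).
Proof. by apply: eq_bigl => i; rewrite revpV Des_compl. Qed.

End Symmetries.

(** * Insertion of the maximal value *)

Section InsertMax.
Variables (n : nat) (i : 'I_n.+1) (s : 'S_n).

Definition insert_max : 'S_n.+1 := lift_perm i ord_max s.

Lemma insert_max_id : insert_max i = ord_max. Proof. exact: lift_perm_id. Qed.

Lemma insert_max_lift (a : 'I_n) : insert_max (lift i a) = s a :> nat.
Proof. by rewrite /insert_max lift_perm_lift lift_max. Qed.

Lemma ninv_insert_max : ninv insert_max = ninv s + (n - i).
Proof.
rewrite !ninvE (bigD1_ord i) //= (bigD1_ord i) //= ltnn add0n addnC; congr (_ + _).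
  apply: eq_bigr => a _; rewrite (bigD1_ord i) //= insert_max_id insert_max_lift.
  rewrite [ord_max < _]ltnNge (ltnW (ltn_ord (s a))) andbF add0n; apply: eq_bigr => b _.
  by rewrite !insert_max_lift -/(lift i a < lift i b) ltn_lift.
rewrite -(sum_ord_geq n i); apply: eq_bigr => a _.
rewrite insert_max_id insert_max_lift ltn_ord andbT /bump.
by congr (nat_of_bool _); case: leqP => /=; lia.
Qed.

Lemma card_records_insert_max right :
  #|records right true insert_max| = #|records right true s| + (i == ord_end n right).
Proof.
rewrite !card_set_sum (bigD1_ord i) //= addnC; congr (_ + _).
  apply: eq_bigr => a _; rewrite (forall_ord_lift i) insert_max_id.
  rewrite insert_max_lift ltn_ord implybT; congr (nat_of_bool _).
  apply: eq_forallb => b; rewrite !insert_max_lift.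
  by case: right; rewrite /ltn_dir ltn_lift.
congr (nat_of_bool _); apply/forallP/eqP => [min_i|-> j]; last by rewrite ord_end_ltn_dir.
apply/eqP; have := min_i (ord_end n right); rewrite ltn_dir_ord_end insert_max_id.
by rewrite /ltn_dir [ord_max < _]ltnNge leq_ord implybF negbK.
Qed.

End InsertMax.

Lemma lmaxima_of_max n (i : 'I_n.+1) (s : 'S_n) (t : 'S_n.+1) :
  t i = ord_max -> (forall j : 'I_n, j < i -> t (lift ord_max j) = s j :> nat) ->
  lmaxima t = i |: [set lift ord_max j | j in lmaxima s & j < i].
Proof.
move=> ti tE; apply/setP => k; rewrite in_setU1.
have lift_lt (j : 'I_n) : (lift ord_max j < i) = (j < i) by rewrite lift_max.
have [->|ne_ki] := eqVneq k i.
  rewrite inE; apply/forallP => j; apply/implyP => lt_ji; rewrite /ltn_dir ti ltn_ord_max.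
  by apply: contraTneq lt_ji; rewrite -ti => /perm_inj ->; rewrite /ltn_dir ltnn.
have [lt_ki|le_ik] := ltnP k i; last first.
  have lt_ik : i < k by rewrite ltn_neqAle le_ik eq_sym andbT.
  have -> : (k \in lmaxima t) = false.
    by rewrite inE; apply/forallPn; exists i; rewrite /ltn_dir lt_ik ti ltnNge leq_ord.
  apply/esym/imsetP => -[j]; rewrite inE => /andP[_ lt_ji] def_k.
  by move: lt_ik; rewrite def_k lift_max ltnNge ltnW.
case: (unliftP ord_max k) lt_ki => [j|] -> lt_ki; last by rewrite ltnNge leq_ord in lt_ki.
rewrite lift_lt in lt_ki.
rewrite (mem_imset _ _ (@lift_inj _ _)) !inE lt_ki andbT (forall_ord_lift ord_max) -[RHS]andTb.
congr (_ && _); first by rewrite /ltn_dir ltnNge leq_ord.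
apply: eq_forallb => l; rewrite /ltn_dir ltn_lift; case: ltnP => //= lt_lj.
by rewrite !tE // (ltn_trans lt_lj).
Qed.

Lemma lmaxima_insert_max n (i : 'I_n.+1) (s : 'S_n) :
  lmaxima (insert_max i s) = i |: [set lift ord_max j | j in lmaxima s & j < i].
Proof.
apply: lmaxima_of_max => [|j lt_ji]; first exact: insert_max_id.
rewrite -(insert_max_lift i s j); congr (val (insert_max i s _)); apply: val_inj.
by rewrite /= /bump [i <= j]leqNgt [n <= j]leqNgt lt_ji ltn_ord.
Qed.

Lemma insertion_bij n (ins : 'I_n.+1 -> 'S_n -> 'S_n.+1) :
  (forall i s, ins i s i = ord_max) -> (forall i, injective (ins i)) ->
  bijective (fun p : 'I_n.+1 * 'S_n => ins p.1 p.2).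
Proof.
move=> ins_id ins_inj; apply: inj_card_bij => [[i s] [j t] /= eq_ins|].
  have eq_ij : i = j by apply: (@perm_inj _ (ins i s)); rewrite ins_id eq_ins ins_id.
  by move: eq_ins; rewrite eq_ij => /ins_inj ->.
by rewrite card_prod !card_Sn card_ord factS.
Qed.

Lemma insert_max_bij n : bijective (fun p : 'I_n.+1 * 'S_n => insert_max p.1 p.2).
Proof.
apply: insertion_bij => [|i s t eq_ins]; first exact: insert_max_id.
by apply/permP => a; apply: val_inj; rewrite /= -!(insert_max_lift i) eq_ins.
Qed.

(** * Sorting *)

Definition lift_max_perm n (s : 'S_n) : 'S_n.+1 := lift_perm ord_max ord_max s.

Section LiftMaxPerm.
Variable n : nat.
Implicit Types (s : 'S_n) (a b : 'I_n).

Lemma lift_max_perm_max s : lift_max_perm s ord_max = ord_max.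
Proof. exact: lift_perm_id. Qed.

Lemma lift_max_perm_lift s a : lift_max_perm s (lift ord_max a) = lift ord_max (s a).
Proof. exact: lift_perm_lift. Qed.

Lemma lift_max_perm_inj : injective (@lift_max_perm n).
Proof.
move=> s t eq_st; apply/permP => a; apply: (@lift_inj _ ord_max).
by rewrite -!lift_max_perm_lift eq_st.
Qed.

Lemma lift_max_perm1 : @lift_max_perm n 1 = 1%g.
Proof. exact: lift_perm1. Qed.

Lemma lift_max_permM s (t : 'S_n) : lift_max_perm (s * t) = (lift_max_perm s * lift_max_perm t)%g.
Proof. by rewrite /lift_max_perm lift_permM. Qed.

Lemma lift_max_permX s k : lift_max_perm (s ^+ k) = (lift_max_perm s ^+ k)%g.
Proof. by elim: k => [|k IHk]; rewrite ?expg0 ?lift_max_perm1 // !expgS lift_max_permM IHk. Qed.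

Lemma lift_max_perm_tperm a b :
  lift_max_perm (tperm a b) = tperm (lift ord_max a) (lift ord_max b).
Proof.
apply/permP => j; case: (unliftP ord_max j) => [k|] ->.
  by rewrite lift_max_perm_lift inj_tperm //; apply: lift_inj.
by rewrite lift_max_perm_max tpermD // eq_sym neq_lift.
Qed.

Lemma porbit_lift_max_perm_max s : porbit (lift_max_perm s) ord_max = [set ord_max].
Proof.
apply/setP => j; rewrite inE.
apply/porbitP/eqP => [[k ->]|->]; last by exists 0; rewrite expg0 perm1.
by rewrite -lift_max_permX lift_max_perm_max.
Qed.

Lemma porbit_lift_max_perm_lift s a :
  porbit (lift_max_perm s) (lift ord_max a) = lift ord_max @: porbit s a.
Proof.
apply/setP => j; apply/porbitP/imsetP => [[k ->]|[b /porbitP[k ->] ->]].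
  by exists ((s ^+ k)%g a); rewrite ?mem_porbit // -lift_max_permX lift_max_perm_lift.
by exists k; rewrite -lift_max_permX lift_max_perm_lift.
Qed.

Lemma porbits_lift_max_perm s :
  porbits (lift_max_perm s) = [set ord_max] |: [set lift ord_max @: A | A : {set _} in porbits s].
Proof.
apply/setP => A; rewrite in_setU1.
apply/imsetP/orP => [[j _ ->]|[/eqP ->|/imsetP[B /imsetP[a _ ->] ->]]].
- case: (unliftP ord_max j) => [a|] ->; last by left; rewrite porbit_lift_max_perm_max.
  by right; rewrite porbit_lift_max_perm_lift; do 2 apply: imset_f.
- by exists ord_max; rewrite ?porbit_lift_max_perm_max.
- by exists (lift ord_max a); rewrite ?porbit_lift_max_perm_lift.
Qed.

Lemma cyc_lift_max_perm s : cyc (lift_max_perm s) = (cyc s).+1.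
Proof.
rewrite /cyc porbits_lift_max_perm cardsU1 card_imset; last exact/imset_inj/lift_inj.
case: imsetP => // -[B _ /setP/(_ ord_max)].
by rewrite inE eqxx => /esym/imsetP[a _ /eqP]; rewrite (negPf (neq_lift _ _)).
Qed.

Lemma sorE s w : sort_fact s w -> sor s = \sum_(t <- w) (t.2 - t.1).
Proof. by move=> sw; rewrite /sor (sort_fact_uniq (xchooseP (sort_fact_ex s)) sw). Qed.

Lemma sort_fact_lift_max_perm s w :
  sort_fact s w ->
  sort_fact (lift_max_perm s) [seq (lift ord_max t.1, lift ord_max t.2) | t <- w].
Proof.
case/and3P => lt_w sorted_w /eqP ->; apply/and3P; split.
- by rewrite all_map; apply: sub_all lt_w => t; rewrite -(ltn_lift ord_max).
- rewrite -map_comp (eq_map (g := fun t : 'I_n * 'I_n => val t.2)) // => t.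
  exact: lift_max.
apply/eqP; rewrite -map_rev big_map (big_morph _ lift_max_permM lift_max_perm1).
by apply: eq_bigr => t _; rewrite lift_max_perm_tperm.
Qed.

End LiftMaxPerm.

(* Multiplication by (i, n + 1): the last step of the sorting factorisation. *)
Section InsertSort.
Variables (n : nat) (i : 'I_n.+1) (s : 'S_n).

Definition insert_sort : 'S_n.+1 := (tperm i ord_max * lift_max_perm s)%g.

Lemma insert_sort_id : insert_sort i = ord_max.
Proof. by rewrite /insert_sort permM tpermL lift_max_perm_max. Qed.

Lemma insert_sortV_max : (insert_sort^-1)%g ord_max = i.
Proof. by rewrite -insert_sort_id permK. Qed.

Lemma insert_sortV_lift (a : 'I_n) : (insert_sort^-1)%g (lift ord_max a) =
  if lift ord_max ((s^-1)%g a) == i then ord_max else lift ord_max ((s^-1)%g a).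
Proof.
rewrite /insert_sort invMg tpermV permM /lift_max_perm lift_permV lift_perm_lift.
case: eqVneq => [->|ne_i]; first by rewrite tpermL.
by rewrite tpermD 1?eq_sym // eq_sym neq_lift.
Qed.

Lemma lmaxima_insert_sort :
  lmaxima insert_sort = i |: [set lift ord_max j | j in lmaxima s & j < i].
Proof.
apply: lmaxima_of_max => [|j lt_ji]; first exact: insert_sort_id.
rewrite /insert_sort permM tpermD ?lift_max_perm_lift ?lift_max ?neq_lift //.
by rewrite -(inj_eq val_inj) [val (lift _ _)]lift_max neq_ltn lt_ji orbT.
Qed.

Lemma sor_insert_sort : sor insert_sort = sor s + (n - i).
Proof.
have fact_s := xchooseP (sort_fact_ex s); set w := xchoose _ in fact_s.
have fact_lift := sort_fact_lift_max_perm fact_s; set w' := map _ _ in fact_lift.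
have sum_w' : \sum_(t <- w') (t.2 - t.1) = sor s.
  by rewrite (sorE fact_s) big_map; apply: eq_bigr => t _; rewrite !lift_max.
have [eq_i|ne_i] := eqVneq i ord_max.
  by rewrite /insert_sort eq_i tperm1 mul1g (sorE fact_lift) sum_w' subnn addn0.
have fact_ins : sort_fact insert_sort (rcons w' (i, ord_max)).
  rewrite sort_fact_rcons /insert_sort mulgA tperm2 mul1g fact_lift andbT ltn_ord_max ne_i /=.
  by apply/allP => _ /mapP[t _ ->]; rewrite ltn_ord_max eq_sym neq_lift.
by rewrite (sorE fact_ins) -cats1 big_cat big_seq1 sum_w'.
Qed.

Lemma cyc_insert_sort : cyc insert_sort = cyc s + (i == ord_max).
Proof.
have := porbits_mul_tperm (lift_max_perm s) i ord_max.
rewrite /= porbit_lift_max_perm_max in_set1 -!/(cyc _) cyc_lift_max_perm -/insert_sort.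
by case: (i == ord_max) => /=; lia.
Qed.

End InsertSort.

Lemma insert_sort_bij n : bijective (fun p : 'I_n.+1 * 'S_n => insert_sort p.1 p.2).
Proof.
apply: insertion_bij => [|i s t /mulgI]; first exact: insert_sort_id.
exact: lift_max_perm_inj.
Qed.

Inductive first_hit (T : Type) (f : T -> T) (P : pred T) : T -> T -> Prop :=
| FirstHitNow x : P (f x) -> first_hit f P x (f x)
| FirstHitLater x y : ~~ P (f x) -> first_hit f P (f x) y -> first_hit f P x y.

Section FirstHit.
Variables (T : Type) (f : T -> T) (P : pred T).

Lemma first_hit_uniq x y z : first_hit f P x y -> first_hit f P x z -> y = z.
Proof.
move=> hit_y; elim: hit_y z => {x y} [x Px|x y nPx _ IHy] z hit_z.
  by case: hit_z Px => // u v nPu _; rewrite (negPf nPu).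
by apply: IHy; case: hit_z nPx => // u Pu; rewrite Pu.
Qed.

Lemma first_hit_iter k x :
  P (iter k.+1 f x) -> (forall m, m < k -> ~~ P (iter m.+1 f x)) ->
  first_hit f P x (iter k.+1 f x).
Proof.
elim: k x => [|k IHk] x Pk minP; first exact: FirstHitNow.
rewrite iterSr in Pk *; apply: FirstHitLater; first exact: (minP 0).
by apply: IHk => // m lt_mk; rewrite -iterSr; apply: minP.
Qed.

(* The orbit of h x under g is the image of the orbit of x under f, except that
   it may make detours of one step outside Q. *)
Lemma first_hit_detour (U : Type) (g : U -> U) (Q : pred U) (h : T -> U) x y :
  (forall z, Q (h z) = P z) ->
  (forall z, g (h z) = h (f z) \/ ~~ Q (g (h z)) /\ g (g (h z)) = h (f z)) ->
  first_hit f P x y -> first_hit g Q (h x) (h y).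
Proof.
move=> QhE gh; elim=> {x y} [x Px|x y nPx _ IHy].
  case: (gh x) => [ghx|[nQ gghx]]; first by rewrite -ghx; constructor; rewrite ghx QhE.
  by apply: FirstHitLater => //; rewrite -gghx; constructor; rewrite gghx QhE.
case: (gh x) => [ghx|[nQ gghx]]; first by apply: FirstHitLater; rewrite ghx ?QhE.
by apply: (FirstHitLater nQ); apply: FirstHitLater; rewrite gghx ?QhE.
Qed.

End FirstHit.

Lemma first_hit_Bcode n (s : 'S_n) (i : 'I_n) :
  first_hit (s^-1)%g (fun j : 'I_n => j <= i) i (Bcode s i).
Proof.
rewrite /Bcode; case: ex_minnP => -[//|k] /= le_k min_k.
have invXE m : (s ^- m)%g i = iter m (s^-1)%g i by rewrite -expgVn permX.
rewrite invXE in le_k *; apply: first_hit_iter => // m lt_mk.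
by apply: contraTN lt_mk => le_m; rewrite -leqNgt -ltnS min_k // invXE.
Qed.

Lemma Bcode_insert_sort_max n (i : 'I_n.+1) (s : 'S_n) : Bcode (insert_sort i s) ord_max = i.
Proof.
apply: first_hit_uniq (first_hit_Bcode _ _) _.
rewrite -[X in first_hit _ _ _ X](insert_sortV_max i s); constructor.
exact: leq_ord.
Qed.

Lemma Bcode_insert_sort_lift n (i : 'I_n.+1) (s : 'S_n) (a : 'I_n) :
  Bcode (insert_sort i s) (lift ord_max a) = lift ord_max (Bcode s a).
Proof.
apply: first_hit_uniq (first_hit_Bcode _ _) _.
apply: first_hit_detour (first_hit_Bcode s a) => b; first by rewrite !lift_max.
rewrite insert_sortV_lift; case: eqVneq => [eq_i|_]; last by left.
by right; rewrite insert_sortV_max lift_max -ltnNge ltn_ord.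
Qed.

Lemma lmic1_insert_sort n (i : 'I_n.+1) (s : 'S_n) :
  lmic1 (insert_sort i s) = lmic1 s + (i == ord0).
Proof.
rewrite /lmic1 !card_set_sum (bigD1_ord ord_max) //= addnC Bcode_insert_sort_max.
by congr (_ + _); apply: eq_bigr => a _; rewrite Bcode_insert_sort_lift lift_max.
Qed.

Lemma sor_to_ninv n : exists2 phi : 'S_n -> 'S_n, injective phi &
  forall s, [/\ ninv (phi s) = sor s, rmin (phi s) = cyc s, lmin (phi s) = lmic1 s
              & lmaxima (phi s) = lmaxima s].
Proof.
elim: n => [|n [phi phi_inj phiE]].
  exists id => // s; split=> //.
  - rewrite (@sorE _ s [::]) ?big_nil; first by apply: eq_card0 => -[[]].
    by rewrite /sort_fact big_nil; apply/eqP/permP => -[].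
  - by rewrite /cyc [RHS]eq_card0 => [|A]; [apply: eq_card0 => -[] | apply/imsetP => -[[]]].
  - by rewrite /lmin /lmic1 !eq_card0 // => -[].
have [g _ gK] := insert_sort_bij n.
exists (fun t => insert_max (g t).1 (phi (g t).2)) => [t u|t].
  move/(bij_inj (insert_max_bij n) (x1 := ((g t).1, _)) (x2 := ((g u).1, _))).
  case=> eq1 /phi_inj eq2; apply: (can_inj gK).
  by rewrite [g t]surjective_pairing eq1 eq2 -surjective_pairing.
case def_g: (g t) => [i s] /=; have {t def_g} <- : insert_sort i s = t by rewrite -[RHS]gK def_g.
have [ninv_phi rmin_phi lmin_phi lmax_phi] := phiE s; split.
- by rewrite ninv_insert_max sor_insert_sort ninv_phi.
- by rewrite recordsE card_records_insert_max cyc_insert_sort -rmin_phi.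
- by rewrite recordsE card_records_insert_max lmic1_insert_sort -lmin_phi.
by rewrite lmaxima_insert_max lmaxima_insert_sort lmax_phi.
Qed.

(** * Foata's second fundamental transformation *)

Section BlockRotation.
Variables (T : eqType) (p : pred T).

Inductive block_word : seq T -> Prop :=
| BlockNil : block_word [::]
| BlockCat u a w : all (predC p) u -> p a -> block_word w -> block_word (u ++ a :: w).

Lemma block_word_rcons w a : p a -> block_word (rcons w a).
Proof.
move=> pa; elim: w => [|b w IHw] /=; first exact: (@BlockCat [::] a _ _ pa BlockNil).
case pb: (p b); first exact: (@BlockCat [::] b _ _ pb IHw).
case def_w: _ / IHw => [|u c v pu pc bv]; first by case: (w) def_w.
by apply: (@BlockCat (b :: u)) => //=; rewrite pb.
Qed.

(* Moves the last letter of each block to its front; acc is the part of the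
   current block that has been read. *)
Fixpoint block_rot (acc w : seq T) : seq T :=
  if w is a :: w' then
    if p a then a :: acc ++ block_rot [::] w' else block_rot (rcons acc a) w'
  else acc.

Lemma block_rot_cat acc u a w : all (predC p) u -> p a ->
  block_rot acc (u ++ a :: w) = a :: (acc ++ u) ++ block_rot [::] w.
Proof.
move=> + pa; elim: u acc => [|b u IHu] acc /=; first by rewrite pa cats0.
by case/andP => /negPf -> /IHu ->; rewrite cat_rcons.
Qed.

Lemma perm_block_rot w : block_word w -> perm_eq (block_rot [::] w) w.
Proof.
elim=> {w} // u a w pu pa _ IHw; rewrite block_rot_cat //=.
by rewrite -cat1s perm_catCA perm_cat2l perm_cons.
Qed.

Lemma filter_block_rot (q : pred T) w :
  (forall a b, q a -> q b -> p a = p b) -> block_word w ->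
  filter q (block_rot [::] w) = filter q w.
Proof.
move=> q_side; elim=> {w} // u a w pu pa _ IHw; rewrite block_rot_cat //=.
rewrite !filter_cat /= IHw; case qa: (q a) => //.
have -> // : filter q u = [::].
apply/eqP; rewrite -[_ == _]negbK -has_filter; apply/hasPn => b /(allP pu).
by apply: contraNN => qb; rewrite (q_side b a).
Qed.

Lemma find_block_rot w : block_word w -> find p (block_rot [::] w) = 0.
Proof. by case=> // u a v pu pa _; rewrite block_rot_cat //= pa. Qed.

Lemma block_rot_inj w1 w2 : block_word w1 -> block_word w2 ->
  block_rot [::] w1 = block_rot [::] w2 -> w1 = w2.
Proof.
move=> bw1; elim: bw1 w2 => {w1} [|u1 a1 w1 pu1 pa1 bw1 IHw1] _ [|u2 a2 w2 pu2 pa2 bw2];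
  rewrite ?block_rot_cat //= => -[-> eq_rot].
have find_cat_rot u w : all (predC p) u -> block_word w ->
    find p (u ++ block_rot [::] w) = size u.
  by rewrite all_predC find_cat => /negPf -> /find_block_rot ->; rewrite addn0.
have eq_size : size u1 = size u2.
  by rewrite -(find_cat_rot _ w1) // eq_rot find_cat_rot.
by move/eqP: eq_rot; rewrite eqseq_cat // => /andP[/eqP -> /eqP/(IHw1 _ bw2) ->].
Qed.

End BlockRotation.

Section WordStatistics.
Implicit Types (w v u : seq nat) (x a b : nat).

Fixpoint winv w : nat :=
  if w is a :: w' then count (fun b => b < a) w' + winv w' else 0.

Definition cross_inv w v : nat := \sum_(a <- w) count (fun b => b < a) v.

Lemma cross_inv0 w : cross_inv w [::] = 0.
Proof. exact: big1. Qed.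

Lemma cross_inv_consr w a v :
  cross_inv w (a :: v) = count (fun b => a < b) w + cross_inv w v.
Proof. by rewrite -sum1_count big_mkcond -big_split; apply: eq_bigr => b _ /=; case: ltnP. Qed.

Lemma cross_inv_perm w v v' : perm_eq v v' -> cross_inv w v = cross_inv w v'.
Proof. by move/seq.permP => eq_count; apply: eq_bigr => a _. Qed.

Lemma winv_cat w v : winv (w ++ v) = winv w + winv v + cross_inv w v.
Proof.
elim: w => [|a w IHw] /=; first by rewrite /cross_inv big_nil addn0.
by rewrite IHw /cross_inv big_cons count_cat; lia.
Qed.

Lemma winv_rcons w x : winv (rcons w x) = winv w + count (fun b => x < b) w.
Proof. by rewrite -cats1 winv_cat cross_inv_consr cross_inv0 !addn0. Qed.

(* A letter in p jumps over the letters of its block, which are all smaller if c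
   holds and all larger otherwise. *)
Lemma winv_block_rot (c : bool) (p : pred nat) w :
  (forall a b, p a -> ~~ p b -> (b < a) = c /\ (a < b) = ~~ c) -> block_word p w ->
  winv (block_rot p [::] w) + ~~ c * count (predC p) w = winv w + c * count (predC p) w.
Proof.
move=> cP; elim=> {w} [|u a w pu pa bw IHw]; first by rewrite /= !muln0.
rewrite block_rot_cat //= !winv_cat /=.
have count_u (q : pred nat) d : (forall b, ~~ p b -> q b = d) -> count q u = d * size u.
  move=> qE; rewrite (eq_in_count (a2 := fun=> d)) => [|b /(allP pu)/qE //].
  by case: d {qE}; rewrite ?mul1n ?(count_predT, count_pred0).
rewrite !count_cat /= pa cross_inv_consr (cross_inv_perm u (perm_block_rot bw)).
rewrite (seq.permP (perm_block_rot bw)) (count_u (predC p) true) //.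
rewrite (count_u _ c) => [|b /(cP a b pa)[]//]; rewrite (count_u _ (~~ c)) => [|b /(cP a b pa)[]//].
by case: (c) IHw => /=; lia.
Qed.

Definition wmaj w : nat := \sum_(i < (size w).-1 | nth 0 w i.+1 < nth 0 w i) i.+1.

Lemma wmaj_rcons w x : wmaj (rcons w x) = wmaj w + (x < last x w) * size w.
Proof.
case/lastP: w => [|w y]; first by rewrite /wmaj !big_ord0 ltnn.
rewrite /wmaj !size_rcons [LHS]big_mkcond big_ord_recr -big_mkcond last_rcons /=.
rewrite !nth_rcons !size_rcons ltnSn !ltnn !eqxx; congr (_ + _); last by case: ltnP; lia.
by apply: eq_bigl => i; rewrite !nth_rcons !size_rcons !ltnS (ltn_ord i) (ltnW (ltn_ord i)).
Qed.

Fixpoint rtl_records (r : rel nat) w : seq nat :=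
  if w is a :: w' then if all (r a) w' then a :: rtl_records r w' else rtl_records r w'
  else [::].

Lemma rtl_records_rcons (r : rel nat) w x :
  rtl_records r (rcons w x) = rcons [seq a <- rtl_records r w | r a x] x.
Proof.
elim: w => //= a w IHw; rewrite all_rcons IHw; case: (all (r a) w) => /=.
  by rewrite andbT; case: (r a x).
by rewrite andbF.
Qed.

Lemma filter_rtl_records (r : rel nat) w x :
  (forall a b, r a x -> ~~ r b x -> r a b) ->
  [seq a <- rtl_records r w | r a x] = rtl_records r [seq a <- w | r a x].
Proof.
move=> rP; elim: w => //= a w IHw; case ax: (r a x) => /=; last first.
  by case: (all _ w) => //=; rewrite ax.
rewrite all_filter [all _ w in RHS](eq_in_all (a2 := r a)).
  by rewrite -IHw; case: (all (r a) w); rewrite /= ?ax.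
by move=> b _ /=; case bx: (r b x) => //=; rewrite rP ?bx.
Qed.

(* Foata's two cases, last x w <= x and x < last x w, in one formula. *)
Definition foata_side x w : pred nat := fun a => (x < a) == (x < last x w).

Definition foata_step x w : seq nat := block_rot (foata_side x w) [::] w.

Definition foata w : seq nat := foldl (fun v x => rcons (foata_step x v) x) [::] w.

Lemma foata_rcons w x : foata (rcons w x) = rcons (foata_step x (foata w)) x.
Proof. by rewrite /foata foldl_rcons. Qed.

Lemma block_word_foata_side x w : block_word (foata_side x w) w.
Proof.
case/lastP: w => [|w a]; first exact: BlockNil.
by apply: block_word_rcons; rewrite /foata_side last_rcons.
Qed.

Lemma perm_foata_step x w : perm_eq (foata_step x w) w.
Proof. exact/perm_block_rot/block_word_foata_side. Qed.

Lemma foata_step_head x w : (x < head x (foata_step x w)) = (x < last x w).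
Proof.
have := find_block_rot (block_word_foata_side x w); rewrite -/(foata_step x w).
have := perm_foata_step x w; case: (foata_step x w) => [|a v] /=.
  by rewrite perm_sym => /perm_nilP ->.
by rewrite /foata_side; case: eqP.
Qed.

Lemma foata_step_inj x : injective (foata_step x).
Proof.
move=> w1 w2 eq_step.
have eq_side : foata_side x w1 = foata_side x w2.
  by rewrite /foata_side -!foata_step_head eq_step.
move: eq_step (block_word_foata_side x w1); rewrite /foata_step eq_side => eq_rot bw1.
exact: block_rot_inj bw1 (block_word_foata_side x w2) eq_rot.
Qed.

Lemma winv_foata_step x w :
  winv (rcons (foata_step x w) x) = winv w + (x < last x w) * size w.
Proof.
rewrite winv_rcons (seq.permP (perm_foata_step x w)); set c := x < last x w.
have count_gt : count (fun b => x < b) w =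
    count (if c then foata_side x w else predC (foata_side x w)) w.
  by case def_c: c; apply: eq_count => b; rewrite /= /foata_side -/c def_c; case: (x < b).
have sideP a b : foata_side x w a -> ~~ foata_side x w b -> (b < a) = c /\ (a < b) = ~~ c.
  by rewrite /foata_side -/c; case: (c); lia.
have := winv_block_rot sideP (block_word_foata_side x w).
have := count_predC (foata_side x w) w.
by rewrite count_gt -/(foata_step x w); case: (c) => /=; lia.
Qed.

Lemma perm_foata w : perm_eq (foata w) w.
Proof.
elim/last_ind: w => // w x IHw; rewrite foata_rcons -!cats1 perm_cat2r.
exact: perm_trans (perm_foata_step _ _) IHw.
Qed.

Lemma foata_inj : injective foata.
Proof.
elim/last_ind => [|w1 x1 IHw1] w2; case/lastP: w2 => [|w2 x2] //.
- by move/(congr1 size); rewrite foata_rcons size_rcons.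
- by move/(congr1 size); rewrite foata_rcons size_rcons.
rewrite !foata_rcons => /rcons_inj[eq_step eq_x]; rewrite eq_x in eq_step *.
by rewrite (IHw1 w2) //; apply: foata_step_inj eq_step.
Qed.

Lemma last_foata x w : last x (foata w) = last x w.
Proof. by case/lastP: w => // w a; rewrite foata_rcons !last_rcons. Qed.

Lemma winv_foata w : winv (foata w) = wmaj w.
Proof.
elim/last_ind: w => [|w x IHw]; first by rewrite /wmaj big_ord0.
by rewrite foata_rcons winv_foata_step wmaj_rcons IHw last_foata (perm_size (perm_foata w)).
Qed.

(* Appending x keeps only the records on one side of x, and the letters on that
   side are not reordered by a foata_step at x. *)
Lemma rtl_records_foata up w :
  rtl_records (ltn_dir up) (foata w) = rtl_records (ltn_dir up) w.
Proof.
elim/last_ind: w => // w x IHw; rewrite foata_rcons !rtl_records_rcons -IHw.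
have one_side a b : ltn_dir up a x -> ~~ ltn_dir up b x -> ltn_dir up a b.
  by rewrite /ltn_dir; case: (up); lia.
rewrite !filter_rtl_records // filter_block_rot //; last exact: block_word_foata_side.
by move=> a b; rewrite /foata_side /ltn_dir; case: (up); lia.
Qed.

End WordStatistics.

Definition values n (f : 'I_n -> nat) : seq nat := [seq f i | i <- enum 'I_n].

Lemma valuesS n (f : 'I_n.+1 -> nat) :
  values f = f ord0 :: values (fun i => f (lift ord0 i)).
Proof. by rewrite /values enum_ordSl /= -map_comp. Qed.

Lemma count_values n (f : 'I_n -> nat) (P : pred nat) :
  count P (values f) = \sum_(i < n) P (f i).
Proof.
rewrite count_map -sum1_count big_enum_cond big_mkcond.
by apply: eq_bigr => i _ /=; case: (P _).
Qed.

Lemma winv_values n (f : 'I_n -> nat) :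
  winv (values f) = \sum_(i < n) \sum_(j < n) ((i < j) && (f j < f i)).
Proof.
elim: n f => [|n IHn] f; first by rewrite big_ord0 /values enum_ord0.
rewrite valuesS !big_ord_recl /= add0n IHn count_values; congr (_ + _).
by apply: eq_bigr => i _; rewrite big_ord_recl.
Qed.

Lemma size_rtl_records_values n (r : rel nat) (f : 'I_n -> nat) :
  size (rtl_records r (values f)) =
  #|[set i : 'I_n | [forall j : 'I_n, (i < j) ==> r (f i) (f j)]]|.
Proof.
rewrite card_set_sum; elim: n f => [|n IHn] f; first by rewrite big_ord0 /values enum_ord0.
rewrite valuesS big_ord_recl (forall_ord_lift ord0) /= fun_if /= IHn.
have -> : all (r (f ord0)) (values (fun i => f (lift ord0 i))) =
    [forall j : 'I_n, r (f ord0) (f (lift ord0 j))].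
  rewrite all_map; apply/allP/forallP => [all_r j|all_r j _]; last exact: all_r.
  by apply: all_r; rewrite mem_enum.
under [X in _ = _ + X]eq_bigr do rewrite (forall_ord_lift ord0).
by case: ifP.
Qed.

Definition word n (s : 'S_n) : seq nat := values (fun i => s i).

Lemma size_word n (s : 'S_n) : size (word s) = n.
Proof. by rewrite size_map size_enum_ord. Qed.

Lemma nth_word n (s : 'S_n) (i : 'I_n) : nth 0 (word s) i = s i.
Proof. by rewrite (nth_map i) ?size_enum_ord // nth_ord_enum. Qed.

Lemma word_inj n : injective (@word n).
Proof. by move=> s t eq_st; apply/permP => i; apply: val_inj; rewrite /= -!nth_word eq_st. Qed.

Lemma wordP n (w : seq nat) : reflect (exists s : 'S_n, w = word s) (perm_eq w (iota 0 n)).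
Proof.
have wordE (s : 'S_n) : [tuple tnth (iota_tuple n 0) (s i) | i < n] = word s :> seq nat.
  by apply: eq_map => i; rewrite (tnth_nth 0) nth_iota ?add0n.
by apply: (iffP (tuple_permP (t := iota_tuple n 0))) => -[s ->]; exists s; rewrite wordE.
Qed.

Lemma ninv_word n (s : 'S_n) : ninv s = winv (word s).
Proof. by rewrite ninvE winv_values. Qed.

Lemma card_records_word n low (s : 'S_n) :
  #|records true low s| = size (rtl_records (ltn_dir low) (word s)).
Proof. by rewrite size_rtl_records_values. Qed.

Lemma maj_word n (s : 'S_n) : maj s = wmaj (word s).
Proof.
rewrite /maj sum_Des /wmaj size_word; case: n s => [|n] s; first by rewrite !big_ord0.
rewrite big_ord_recr /= [X in _ + X]big1 ?addn0; last first.
  by move=> j _; rewrite ltn_eqF ?ltn_ord.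
rewrite [RHS]big_mkcond; apply: eq_bigr => i _; have lt_i : i.+1 < n.+1 by rewrite ltnS.
rewrite (bigD1 (Ordinal lt_i)) //= eqxx big1 ?addn0.
  by rewrite (nth_word s (Ordinal lt_i)) (nth_word s (widen_ord (leqnSn n) i)).
by move=> j ne_j; case: eqP => //= def_j; case/eqP: ne_j; apply: val_inj.
Qed.

Lemma maj_to_ninv n : exists2 phi : 'S_n -> 'S_n, injective phi &
  forall s, [/\ ninv (phi s) = maj s, rmin (phi s) = rmin s & rmax (phi s) = rmax s].
Proof.
have foata_word (s : 'S_n) : exists t : 'S_n, word t == foata (word s).
  have [|t ->] := wordP n (foata (word s)) _; last by exists t.
  by apply: perm_trans (perm_foata _) _; apply/wordP; exists s.
pose phi s := xchoose (foata_word s).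
have phiE s : word (phi s) = foata (word s) by apply/eqP/(xchooseP (foata_word s)).
exists phi => [s t /(congr1 (@word n))|s]; first by rewrite !phiE => /foata_inj/word_inj.
by rewrite !recordsE ninv_word !card_records_word phiE winv_foata !rtl_records_foata maj_word.
Qed.

(** * Equidistribution *)

Section Equidistribution.
Variable n : nat.

Lemma equidistributedP (T : eqType) (f g : 'S_n -> T) :
  equidistributed f g <-> perm_eq (map f (enum 'S_n)) (map g (enum 'S_n)).
Proof.
have countE (h : 'S_n -> T) v : count_mem v (map h (enum 'S_n)) = #|[set s | h s == v]|.
  by rewrite count_map -sum1_count big_enum_cond /= sum1dep_card.
split=> [eq_fg|/seq.permP eq_fg v]; last by rewrite -!countE.
by apply/allP => v _; rewrite /= !countE eq_fg.
Qed.

Lemma equidist_trans (T : eqType) (f g h : 'S_n -> T) :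
  equidistributed f g -> equidistributed g h -> equidistributed f h.
Proof. by move=> eq_fg eq_gh v; rewrite eq_fg. Qed.

Lemma equidist_map (T U : eqType) (h : T -> U) (f g : 'S_n -> T) :
  equidistributed f g -> equidistributed (fun s => h (f s)) (fun s => h (g s)).
Proof.
by rewrite !equidistributedP (map_comp h f) (map_comp h g); apply: perm_map.
Qed.

Lemma equidist_reindex (T : eqType) (phi : 'S_n -> 'S_n) (f g : 'S_n -> T) :
  injective phi -> (forall s, f (phi s) = g s) -> equidistributed f g.
Proof.
move=> phi_inj fE v; rewrite !card_set_sum (reindex_inj phi_inj).
by apply: eq_bigr => s _; rewrite fE.
Qed.

Lemma equidist_sum (R : nmodType) (T : eqType) (F : T -> R) (f g : 'S_n -> T) :
  equidistributed f g -> (\sum_s F (f s) = \sum_s F (g s))%R.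
Proof.
have sumE (h : 'S_n -> T) : (\sum_s F (h s) = \sum_(v <- map h (enum 'S_n)) F v)%R.
  by rewrite big_map big_enum.
by move/equidistributedP => eq_fg; rewrite !sumE; apply: perm_big.
Qed.

Local Notation inv_quad := (fun s : 'S_n => (ninv s, rmin s, lmin s, lmax s)).
Local Notation inv_triple := (fun s : 'S_n => (ninv s, rmin s, lmin s)).

Lemma equidist_quad_triple (s1 s2 s3 s4 : 'S_n -> nat) :
  equidistributed inv_quad (fun s => (s1 s, s2 s, s3 s, s4 s)) ->
  equidistributed inv_triple (fun s => (s1 s, s2 s, s3 s)).
Proof. exact: equidist_map fst _ _. Qed.

Lemma equidist_sor_cyc_lmic1 :
  equidistributed inv_quad (fun s => (sor s, cyc s, lmic1 s, lmax s)).
Proof.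
have [phi phi_inj phiE] := sor_to_ninv n; apply: (equidist_reindex phi_inj) => s.
by have [-> -> -> lmax_phi] := phiE s; rewrite !recordsE lmax_phi.
Qed.

Lemma equidist_ninv_lmax_lmin :
  equidistributed inv_quad (fun s => (ninv s, lmax s, lmin s, rmin s)).
Proof. by apply: (equidist_reindex invg_inj) => s; rewrite ninv_inv !record_stats_inv. Qed.

Let revp_compl_inj : injective (fun s : 'S_n => revp (compl s)).
Proof. exact: inj_comp (@revp_inj n) (@compl_inj n). Qed.

Lemma equidist_ninv_lmax_rmax :
  equidistributed inv_quad (fun s => (ninv s, lmax s, rmax s, rmin s)).
Proof.
apply: (equidist_reindex revp_compl_inj) => s.
by rewrite ninv_revp_compl !record_stats_revp !record_stats_compl.
Qed.

Lemma equidist_ninv_rmin_rmax :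
  equidistributed inv_quad (fun s => (ninv s, rmin s, rmax s, lmax s)).
Proof.
apply: equidist_trans equidist_ninv_lmax_lmin (equidist_reindex revp_compl_inj _) => s.
by rewrite ninv_revp_compl !record_stats_revp !record_stats_compl.
Qed.

Lemma equidist_coinv_lmin_rmin :
  equidistributed inv_quad (fun s => (coinv s, lmin s, rmin s, rmax s)).
Proof.
by apply: (equidist_reindex (@revp_inj n)) => s; rewrite ninv_revp !record_stats_revp.
Qed.

Lemma equidist_coinv_rmax_lmax :
  equidistributed inv_quad (fun s => (coinv s, rmax s, lmax s, lmin s)).
Proof.
by apply: (equidist_reindex (@compl_inj n)) => s; rewrite ninv_compl !record_stats_compl.
Qed.

Lemma equidist_coinv_rmax_rmin :
  equidistributed inv_quad (fun s => (coinv s, rmax s, rmin s, lmin s)).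
Proof.
apply: equidist_trans equidist_ninv_lmax_lmin (equidist_reindex (@revp_inj n) _) => s.
by rewrite ninv_revp !record_stats_revp.
Qed.

Lemma equidist_coinv_lmin_lmax :
  equidistributed inv_quad (fun s => (coinv s, lmin s, lmax s, rmax s)).
Proof.
apply: equidist_trans equidist_ninv_lmax_lmin (equidist_reindex (@compl_inj n) _) => s.
by rewrite ninv_compl !record_stats_compl.
Qed.

Lemma equidist_sor_lmax_lmic1 :
  equidistributed inv_quad (fun s => (sor s, lmax s, lmic1 s, cyc s)).
Proof.
apply: equidist_trans equidist_ninv_lmax_lmin _.
exact: (equidist_map (fun '(a, b, c, d) => (a, d, c, b)) equidist_sor_cyc_lmic1).
Qed.

Lemma equidist_cosor_lmic1_cyc :
  equidistributed inv_triple (fun s => (cosor s, lmic1 s, cyc s)).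
Proof.
apply: equidist_trans (equidist_quad_triple equidist_coinv_lmin_rmin) _.
exact: (equidist_map (fun '(a, b, c, _) => ('C(n, 2) - a, c, b)) equidist_sor_cyc_lmic1).
Qed.

Lemma equidist_cosor_lmic1_lmax :
  equidistributed inv_triple (fun s => (cosor s, lmic1 s, lmax s)).
Proof.
apply: equidist_trans (equidist_quad_triple equidist_coinv_lmin_rmin) _.
exact: (equidist_map (fun '(a, b, c, _) => ('C(n, 2) - a, c, b)) equidist_sor_lmax_lmic1).
Qed.

Lemma equidist_coinv_rmin_lmin :
  equidistributed (fun s : 'S_n => (ninv s, lmin s, lmax s)) (fun s => (coinv s, rmin s, lmin s)).
Proof. exact: (equidist_map (fun '(a, _, c, d) => (a, c, d)) equidist_coinv_rmax_rmin). Qed.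

Lemma equidist_cosor_lmax_lmic1 :
  equidistributed (fun s : 'S_n => (ninv s, lmin s, lmax s)) (fun s => (cosor s, lmax s, lmic1 s)).
Proof.
apply: equidist_trans equidist_coinv_rmin_lmin _.
exact: (equidist_map (fun '(a, b, c, _) => ('C(n, 2) - a, b, c)) equidist_sor_lmax_lmic1).
Qed.

Lemma equidist_cosor_cyc_lmic1 :
  equidistributed (fun s : 'S_n => (ninv s, lmin s, lmax s)) (fun s => (cosor s, cyc s, lmic1 s)).
Proof.
apply: equidist_trans equidist_coinv_rmin_lmin _.
exact: (equidist_map (fun '(a, b, c, _) => ('C(n, 2) - a, b, c)) equidist_sor_cyc_lmic1).
Qed.

Lemma equidist_cyc_rmin :
  equidistributed (fun s : 'S_n => (rmin s, lmax s)) (fun s => (cyc s, rmin s)).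
Proof.
apply: equidist_trans (equidist_map (fun '(_, b, _, d) => (b, d)) equidist_sor_cyc_lmic1) _.
by apply: (equidist_reindex invg_inj) => s; rewrite cyc_inv record_stats_inv.
Qed.

Lemma equidist_rmin_cyc :
  equidistributed (fun s : 'S_n => (rmin s, lmax s)) (fun s => (rmin s, cyc s)).
Proof.
apply: equidist_trans (equidist_map (fun '(_, b, _, d) => (b, d)) equidist_sor_lmax_lmic1) _.
by apply: (equidist_reindex invg_inj) => s; rewrite cyc_inv record_stats_inv.
Qed.

Lemma equidist_maj_rmin_rmax :
  equidistributed inv_triple (fun s => (maj s, rmin s, rmax s)).
Proof.
have [phi phi_inj phiE] := maj_to_ninv n.
apply: equidist_trans (equidist_quad_triple equidist_ninv_rmin_rmax) _.
by apply: (equidist_reindex phi_inj) => s; have [-> -> ->] := phiE s.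
Qed.

Lemma equidist_imaj_lmax_rmax :
  equidistributed inv_triple (fun s => (imaj s, lmax s, rmax s)).
Proof.
apply: equidist_trans equidist_maj_rmin_rmax (equidist_reindex invg_inj _) => s.
by rewrite !record_stats_inv.
Qed.

Lemma equidist_rmaj_lmax_lmin :
  equidistributed inv_triple (fun s => (rmaj s, lmax s, lmin s)).
Proof.
apply: equidist_trans equidist_maj_rmin_rmax (equidist_reindex revp_compl_inj _) => s.
by rewrite !record_stats_revp !record_stats_compl.
Qed.

Lemma equidist_chg_rmin_lmin :
  equidistributed inv_triple (fun s => (chg s, rmin s, lmin s)).
Proof.
apply: equidist_trans equidist_rmaj_lmax_lmin (equidist_reindex invg_inj _) => s.
by rewrite -chgE !record_stats_inv.
Qed.

Lemma equidist_cochg_lmin_rmin :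
  equidistributed inv_triple (fun s => (cochg s, lmin s, rmin s)).
Proof.
apply: equidist_trans equidist_chg_rmin_lmin (equidist_reindex (@revp_inj n) _) => s.
by rewrite -cochgE !record_stats_revp.
Qed.

End Equidistribution.

(** * The product formula *)

Lemma gf_identity_equidist n (s1 s2 s3 t1 t2 t3 : 'S_n -> nat) :
  equidistributed (fun s => (s1 s, s2 s, s3 s)) (fun s => (t1 s, t2 s, t3 s)) ->
  gf_identity s1 s2 s3 -> gf_identity t1 t2 t3.
Proof.
move=> eq_st gf_s R q x y; rewrite -gf_s; apply/esym.
exact: (equidist_sum (fun '(a, b, c) => q ^+ a * x ^+ b * y ^+ c)%R eq_st).
Qed.

Lemma sum_insertion_weight (R : comNzRingType) (q x y : R) n : 0 < n ->
  (\sum_(i < n.+1) q ^+ (n - i) * x ^+ (i == ord_max) * y ^+ (i == ord0) =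
   x + qint q n.+1 + y * q ^+ n - 1 - q ^+ n)%R.
Proof.
case: n => // n _; rewrite /qint [in RHS](reindex_inj rev_ord_inj) /=.
rewrite !(bigD1 (P := xpredT) ord_max) // !(bigD1 (P := fun i => i != ord_max) ord0) //=.
rewrite subnn subn0 subSS subnn !eqxx.
rewrite [X in (_ + (_ + X) = _)%R](eq_bigr (fun i : 'I_n.+2 => q ^+ (n.+2 - i.+1))%R); last first.
  by move=> i /andP[/negPf -> /negPf ->]; rewrite !mulr1 subSS.
by rewrite !expr0 !expr1; ring.
Qed.

Lemma sum_ninv_rmin_lminS (R : comNzRingType) (q x y : R) n :
  (\sum_(s : 'S_n.+1) q ^+ ninv s * x ^+ rmin s * y ^+ lmin s =
   (\sum_(s : 'S_n) q ^+ ninv s * x ^+ rmin s * y ^+ lmin s) *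
   \sum_(i < n.+1) q ^+ (n - i) * x ^+ (i == ord_max) * y ^+ (i == ord0))%R.
Proof.
rewrite (reindex _ (onW_bij _ (insert_max_bij n))) /= big_distrlr /= exchange_big pair_bigA /=.
apply: eq_bigr => -[i s] _ /=.
rewrite ninv_insert_max !recordsE !card_records_insert_max !exprD; ring.
Qed.

Lemma gf_identity_ninv_rmin_lmin n : 0 < n -> gf_identity (@ninv n) (@rmin n) (@lmin n).
Proof.
case: n => // n _ R q x y; elim: n => [|n IHn].
  rewrite sum_ninv_rmin_lminS big_geq // mulr1 big_ord1 !expr1 expr0 mul1r.
  rewrite (big_pred1 1%g) => [|s]; last by apply/esym/eqP/permP => -[].
  have no_index (T : finType) (A : {pred T}) : (T -> 'I_0) -> #|A| = 0.
    by move=> to_I0; apply: eq_card0 => u; case: (to_I0 u).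
  by rewrite /ninv /rmin /lmin !no_index ?expr0 ?mul1r // => -[].
by rewrite sum_ninv_rmin_lminS sum_insertion_weight // IHn [in RHS]big_nat_recr //= mulrA subn1.
Qed.

Create HintDb equidist.
#[local] Hint Resolve equidist_sor_cyc_lmic1 equidist_ninv_lmax_lmin equidist_ninv_lmax_rmax
  equidist_ninv_rmin_rmax equidist_coinv_lmin_rmin equidist_coinv_rmax_lmax
  equidist_coinv_rmax_rmin equidist_coinv_lmin_lmax equidist_sor_lmax_lmic1
  equidist_cosor_lmic1_cyc equidist_cosor_lmic1_lmax equidist_cosor_lmax_lmic1
  equidist_cosor_cyc_lmic1 equidist_cyc_rmin equidist_rmin_cyc equidist_maj_rmin_rmax
  equidist_imaj_lmax_rmax equidist_rmaj_lmax_lmin equidist_chg_rmin_lmin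
  equidist_cochg_lmin_rmin : equidist.

Theorem theorem5p2 (n : nat) (n_gt0 : 0 < n) :
  (
   (* (2) *)
      equidistributed (fun s : 'S_n => (ninv s, rmin s, lmin s, lmax s))
        (fun s : 'S_n => (sor s, cyc s, lmic1 s, lmax s)) /\
   (* (3) *)
      equidistributed (fun s : 'S_n => (ninv s, rmin s, lmin s, lmax s))
        (fun s : 'S_n => (ninv s, lmax s, lmin s, rmin s)) /\
   (* (4) *)
      equidistributed (fun s : 'S_n => (ninv s, rmin s, lmin s, lmax s))
        (fun s : 'S_n => (ninv s, rmin s, rmax s, lmax s)) /\
   (* (5) *)
      equidistributed (fun s : 'S_n => (ninv s, rmin s, lmin s, lmax s))
        (fun s : 'S_n => (ninv s, lmax s, rmax s, rmin s)) /\
   (* (6) *)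
      equidistributed (fun s : 'S_n => (ninv s, rmin s, lmin s, lmax s))
        (fun s : 'S_n => (coinv s, lmin s, rmin s, rmax s)) /\
   (* (7) *)
      equidistributed (fun s : 'S_n => (ninv s, rmin s, lmin s, lmax s))
        (fun s : 'S_n => (coinv s, rmax s, lmax s, lmin s)) /\
   (* (8) *)
      equidistributed (fun s : 'S_n => (ninv s, rmin s, lmin s, lmax s))
        (fun s : 'S_n => (coinv s, rmax s, rmin s, lmin s)) /\
   (* (9) *)
      equidistributed (fun s : 'S_n => (ninv s, rmin s, lmin s, lmax s))
        (fun s : 'S_n => (coinv s, lmin s, lmax s, rmax s)) /\
   (* (10) *)
      equidistributed (fun s : 'S_n => (ninv s, rmin s, lmin s, lmax s))
        (fun s : 'S_n => (sor s, lmax s, lmic1 s, cyc s)) /\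
   (* (11) *)
      equidistributed (fun s : 'S_n => (ninv s, rmin s, lmin s))
        (fun s : 'S_n => (cosor s, lmic1 s, cyc s)) /\
   (* (12) *)
      equidistributed (fun s : 'S_n => (ninv s, lmin s, lmax s))
        (fun s : 'S_n => (cosor s, lmax s, lmic1 s)) /\
   (* (13) *)
      equidistributed (fun s : 'S_n => (ninv s, lmin s, lmax s))
        (fun s : 'S_n => (cosor s, cyc s, lmic1 s)) /\
   (* (14) *)
      equidistributed (fun s : 'S_n => (ninv s, rmin s, lmin s))
        (fun s : 'S_n => (cosor s, lmic1 s, lmax s)) /\
   (* (15) *)
      equidistributed (fun s : 'S_n => (rmin s, lmax s))
        (fun s : 'S_n => (cyc s, rmin s)) /\
   (* (16) *)
      equidistributed (fun s : 'S_n => (rmin s, lmax s))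
        (fun s : 'S_n => (rmin s, cyc s)) /\
   (* (17) *)
      equidistributed (fun s : 'S_n => (ninv s, rmin s, lmin s))
        (fun s : 'S_n => (maj s, rmin s, rmax s)) /\
   (* (18) *)
      equidistributed (fun s : 'S_n => (ninv s, rmin s, lmin s))
        (fun s : 'S_n => (imaj s, lmax s, rmax s)) /\
   (* (19) *)
      equidistributed (fun s : 'S_n => (ninv s, rmin s, lmin s))
        (fun s : 'S_n => (rmaj s, lmax s, lmin s)) /\
   (* (20) *)
      equidistributed (fun s : 'S_n => (ninv s, rmin s, lmin s))
        (fun s : 'S_n => (chg s, rmin s, lmin s)) /\
   (* (21) *)
      equidistributed (fun s : 'S_n => (ninv s, rmin s, lmin s))
        (fun s : 'S_n => (cochg s, lmin s, rmin s))
  ) /\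
  (
   (* (1) *) gf_identity (@ninv n) (@rmin n) (@lmin n) /\
   (* (2) *) gf_identity (@sor n) (@cyc n) (@lmic1 n) /\
   (* (3) *) gf_identity (@ninv n) (@lmax n) (@lmin n) /\
   (* (4) *) gf_identity (@ninv n) (@rmin n) (@rmax n) /\
   (* (5) *) gf_identity (@ninv n) (@lmax n) (@rmax n) /\
   (* (6) *) gf_identity (@coinv n) (@lmin n) (@rmin n) /\
   (* (7) *) gf_identity (@coinv n) (@rmax n) (@lmax n) /\
   (* (8) *) gf_identity (@coinv n) (@rmax n) (@rmin n) /\
   (* (9) *) gf_identity (@coinv n) (@lmin n) (@lmax n) /\
   (* (10) *) gf_identity (@sor n) (@lmax n) (@lmic1 n) /\
   (* (11) *) gf_identity (@cosor n) (@lmic1 n) (@cyc n) /\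
   (* (14) *) gf_identity (@cosor n) (@lmic1 n) (@lmax n) /\
   (* (17) *) gf_identity (@maj n) (@rmin n) (@rmax n) /\
   (* (18) *) gf_identity (@imaj n) (@lmax n) (@rmax n) /\
   (* (19) *) gf_identity (@rmaj n) (@lmax n) (@lmin n) /\
   (* (20) *) gf_identity (@chg n) (@rmin n) (@lmin n) /\
   (* (21) *) gf_identity (@cochg n) (@lmin n) (@rmin n)
  ).
Proof.
have gf_inv := gf_identity_ninv_rmin_lmin n_gt0.
have gf_triple s1 s2 s3 (eq_s : equidistributed
    (fun s : 'S_n => (ninv s, rmin s, lmin s)) (fun s => (s1 s, s2 s, s3 s))) :
  gf_identity s1 s2 s3 := gf_identity_equidist eq_s gf_inv.
have gf_quad s1 s2 s3 s4 (eq_s : equidistributed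
    (fun s : 'S_n => (ninv s, rmin s, lmin s, lmax s)) (fun s => (s1 s, s2 s, s3 s, s4 s))) :
  gf_identity s1 s2 s3 := gf_triple _ _ _ (equidist_quad_triple eq_s).
split; first by repeat apply: conj; auto with equidist.
by repeat apply: conj; first [exact: gf_inv | eauto with equidist].
Qed.
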